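(* Fix $m,t\ge 1$, a signature $\sigma$ of length $m$, and $0<\theta<1$. Suppose that \[\sum_{\substack{k\le x\\ k\in\mathcal{K}(t,\sigma)}}\frac{1}{\lambda_{k,m}}\ll x^{o(1)} \quad (x\to\infty).\] Then \[\sum_{\substack{x^\theta\le k\le x\\ k\in\mathcal{K}(t,\sigma)}}\frac{1}{k\,\lambda_{k,m}}\ll x^{-\theta+o(1)}.\]
   Context: Let $b_1,\ldots,b_m$ be the first $m$ primes. For a prime $p$ not among them, its signature is $\sigma_p=(v(\mathrm{ord}_p(b_1)),\ldots,v(\mathrm{ord}_p(b_m)))$, where $v$ is the $2$-adic valuation and $\mathrm{ord}_p(b)$ the multiplicative order of $b$ mod $p$, and $\lambda_{p,m}=\mathrm{lcm}\{\mathrm{ord}_p(b_i):1\le i\le m\}$. $\mathcal{K}(t,\sigma)$ is the set of integers with exactly $t$ distinct prime divisors, each of which has signature equal to $\sigma$. For $k=p_1\cdots p_t\in\mathcal{K}(t,\sigma)$ (distinct primes), $\lambda_{k,m}=\mathrm{lcm}\{\lambda_{p_1,m},\ldots,\lambda_{p_t,m}\}$. *)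

(* Defs.v *)
From mathcomp Require Import all_boot all_order all_algebra all_fingroup.
From mathcomp Require Import all_classical all_reals all_analysis.

Set Implicit Arguments.
Unset Strict Implicit.
Unset Printing Implicit Defensive.

Import Order.TTheory GRing.Theory Num.Theory.
Import numFieldNormedType.Exports.

Lemma ex_prime_above (n : nat) : exists p, (n < p) && prime p.
Proof. by have [p np pp] := prime_above n; exists p; rewrite np. Qed.

Definition next_prime (n : nat) : nat := ex_minn (ex_prime_above n).

(* nth_prime 0 = 2, nth_prime 1 = 3, ...; the base b_i is nth_prime (i - 1). *)
Definition nth_prime (i : nat) : nat := iter i.+1 next_prime 0.

(* The order of b in the group of units of 'F_p, for p prime.
   Junk value 1 when p divides b. *)
Definition ordmod (p b : nat) : nat :=
  #[insubd (1%g : {unit 'F_p}) (b%:R%R : 'F_p)]%g.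

Definition signature (m p : nat) : m.-tuple nat :=
  [tuple logn 2 (ordmod p (nth_prime i)) | i < m].

Definition lambda_prime (m p : nat) : nat :=
  \big[lcmn/1]_(i < m) ordmod p (nth_prime i).

(* A prime only has a signature if it is not one of the m bases. *)
Definition has_signature (m : nat) (sigma : m.-tuple nat) (p : nat) : bool :=
  [forall i : 'I_m, p != nth_prime i] && (signature m p == sigma).

(* The set K(t, sigma): products k = p_1 ... p_t of t distinct primes, all of
   signature sigma. The first conjunct says that k is squarefree. *)
Definition inK (m t : nat) (sigma : m.-tuple nat) (k : nat) : bool :=
  [&& k == \prod_(p <- primes k) p, size (primes k) == t
    & all (has_signature sigma) (primes k)].

Definition lambda (m k : nat) : nat :=
  \big[lcmn/1]_(p <- primes k) lambda_prime m p.

Local Open Scope classical_set_scope.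
Local Open Scope ring_scope.

Section sums.
Context {R : realType}.

(* In both sums the range k <= truncn x only bounds the index; the actual
   condition k <= x is in the filter. *)
Definition sum_inv_lambda (m t : nat) (sigma : m.-tuple nat) (x : R) : R :=
  \sum_(0 <= k < (Num.truncn x).+1 | (k%:R <= x) && inK t sigma k)
    (lambda m k)%:R^-1.

Definition sum_inv_k_lambda (m t : nat) (sigma : m.-tuple nat) (theta x : R) : R :=
  \sum_(0 <= k < (Num.truncn x).+1 | (x `^ theta <= k%:R <= x) && inK t sigma k)
    (k%:R * (lambda m k)%:R)^-1.

(* f(x) << x^(a + o(1)) as x -> +oo. *)
Definition ll_powR_o1 (f : R -> R) (a : R) : Prop :=
  exists2 eps : R -> R, eps x @[x --> +oo] --> (0 : R)
    & exists C : R, \forall x \near +oo, `|f x| <= C * x `^ (a + eps x).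

End sums.

(* Main.v *)
(* Every k in the second sum satisfies 1/k <= x^(-theta), so that sum is at most
   x^(-theta) times the first one, and the same o(1) and constant serve. *)
Require Import Defs.
From mathcomp Require Import all_boot all_order all_algebra all_fingroup.
From mathcomp Require Import all_classical all_reals all_analysis.
Import Order.TTheory GRing.Theory Num.Theory.
Import numFieldNormedType.Exports.

Local Open Scope ring_scope.

Lemma sum_inv_lambda_ge0 (R : realType) (m t : nat) (sigma : m.-tuple nat)
    (x : R) :
  0 <= sum_inv_lambda t sigma x.
Proof. by apply: sumr_ge0 => k _; rewrite invr_ge0. Qed.

Lemma sum_inv_k_lambda_ge0 (R : realType) (m t : nat) (sigma : m.-tuple nat)
    (theta x : R) :
  0 <= sum_inv_k_lambda t sigma theta x.
Proof. by apply: sumr_ge0 => k _; rewrite invr_ge0 mulr_ge0. Qed.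

Lemma sum_inv_k_lambda_le (R : realType) (m t : nat) (sigma : m.-tuple nat)
    (theta x : R) : 0 < x ->
  sum_inv_k_lambda t sigma theta x <=
    x `^ (- theta) * sum_inv_lambda t sigma x.
Proof.
move=> x0; rewrite /sum_inv_k_lambda /sum_inv_lambda mulr_sumr.
(* The filters become zero summands, so that both sums run over one range. *)
rewrite big_mkcond [leRHS]big_mkcond; apply: ler_sum => k _.
have x_gt0 : 0 < x `^ theta by exact: powR_gt0.
case: (lerP (x `^ theta) k%:R) => [xk|_] /=; last first.
  by case: ifP => // _; rewrite mulr_ge0 ?powR_ge0 ?invr_ge0.
case: ifP => // _; rewrite invfM powRN ler_wpM2r ?invr_ge0//.
(* The cutoff also forces k > 0, so inversion reverses the inequality. *)
by rewrite lef_pV2 // posrE (lt_le_trans x_gt0).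
Qed.

Theorem theorem6 (R : realType) (m t : nat) (sigma : m.-tuple nat) (theta : R)
    (hm : (1 <= m)%N) (ht : (1 <= t)%N) (htheta : 0 < theta < 1) :
  ll_powR_o1 (sum_inv_lambda (R := R) t sigma) 0 ->
  ll_powR_o1 (sum_inv_k_lambda t sigma theta) (- theta).
Proof.
case=> eps eps0 [C hC]; exists eps => //; exists C.
have xpos : \forall x \near (+oo%R : set_system R), 0 < x.
  exact: nbhs_pinfty_gt.
apply: filterS2 hC xpos => x; rewrite add0r ger0_norm ?sum_inv_lambda_ge0// => hx x0.
rewrite ger0_norm ?sum_inv_k_lambda_ge0//.
apply: le_trans (sum_inv_k_lambda_le _ _ _ _ _ _ x0) _.
rewrite powRD; last by rewrite (gt_eqF x0) implybT.
by rewrite mulrCA ler_wpM2l ?powR_ge0.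
Qed.
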